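(* Let $d\ge 2$ and let $(U,V)\in\mathbb{R}^d\times\mathbb{R}^d$ be a couple of random vectors, centered ($\mathbb{E}U=\mathbb{E}V=0$) and normalized ($\mathbb{E}|U|^2=\mathbb{E}|V|^2=1$), and assume the isotropy condition $\mathbb{E}(U\otimes U)=\frac1d\mathrm{Id}$. Let $(U_\ast,V_\ast)$ be an i.i.d. copy of $(U,V)$. Let $\alpha>0$ and $p_1,p_2>1$ with $\frac1{p_1}+\frac1{p_2}=1$. Then $$f\big(\mathbb{E}|U-V|^2\big)\le k_\alpha\,\frac{d}{d-1}\,m_{\mathrm{Law}(U),p_1(2+\alpha)}^{\frac{2+\alpha}{1+\alpha}}\,m_{\mathrm{Law}(V),p_2(2+\alpha)}^{\frac{2+\alpha}{1+\alpha}}\;\Big(\mathbb{E}\big[|U-U_\ast||V-V_\ast|-(U-U_\ast)\cdot(V-V_\ast)\big]\Big)^{\frac{\alpha}{1+\alpha}},$$ where $k_\alpha=(1+\alpha)\left(\frac{2}{2+\alpha}\right)^{\frac{2+\alpha}{1+\alpha}}$.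
   Context: $f(x)=x-\frac{x^2}4$. For a random vector $X\in\mathbb{R}^d$ with i.i.d. copy $X_\ast$, and $p\ge1$, $m_{\mathrm{Law}(X),p}=\big(\mathbb{E}|X-X_\ast|^p\big)^{1/p}\in[0,+\infty]$. *)

(* Defs.v *)
From HB Require Import structures.
From mathcomp Require Import all_boot all_order all_algebra.
From mathcomp Require Import all_classical all_reals all_analysis.

Set Implicit Arguments.
Unset Strict Implicit.
Unset Printing Implicit Defensive.

Import Order.TTheory GRing.Theory Num.Theory.
Import numFieldNormedType.Exports.

Local Open Scope classical_set_scope.
Local Open Scope ring_scope.

(* R^d is represented by [d.-tuple R], whose library sigma-algebra is the one
   generated by the coordinate maps, i.e., the Borel sigma-algebra.  The norm is
   the Euclidean one (the norm of ['rV[R]_d] is the sup norm). *)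

Definition vsub (R : realType) (d : nat) (u v : d.-tuple R) : d.-tuple R :=
  [tuple tnth u i - tnth v i | i < d].

Definition dot (R : realType) (d : nat) (u v : d.-tuple R) : R :=
  \sum_(i < d) tnth u i * tnth v i.

Definition enorm (R : realType) (d : nat) (u : d.-tuple R) : R :=
  Num.sqrt (dot u u).

Definition iid_copy (disp disp' : measure_display) (T : measurableType disp)
    (E : measurableType disp') (R : realType) (P : probability T R)
    (X Xs : T -> E) : Prop :=
  (forall A : set E, measurable A ->
     pushforward P Xs A = pushforward P X A) /\
  (forall A B : set E, measurable A -> measurable B ->
     P (X @^-1` A `&` Xs @^-1` B) = (P (X @^-1` A) * P (Xs @^-1` B))%E).

(* m_{Law(X), p}, where [Xs] is an i.i.d. copy of [X]; the value depends on X
   only through its law and may be +oo. *)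
Definition law_moment (disp : measure_display) (T : measurableType disp)
    (R : realType) (P : probability T R) (d : nat) (X Xs : T -> d.-tuple R)
    (p : R) : \bar R :=
  ('E_P[fun w => (enorm (vsub (X w) (Xs w)) `^ p)%R] `^ p^-1)%E.

Definition f (R : realType) (x : R) : R := x - x ^+ 2 / 4.

Definition k_alpha (R : realType) (a : R) : R :=
  (1 + a) * (2 / (2 + a)) `^ ((2 + a) / (1 + a)).

(* Main.v *)
Require Import Defs.
From HB Require Import structures.
From mathcomp Require Import all_boot all_order all_algebra.
From mathcomp Require Import all_classical all_reals all_analysis.
From mathcomp Require Import measurable_realfun ring lra.

Set Implicit Arguments.
Unset Strict Implicit.
Unset Printing Implicit Defensive.

Import Order.TTheory GRing.Theory Num.Theory.
Import numFieldNormedType.Exports.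

Local Open Scope classical_set_scope.
Local Open Scope ring_scope.

(** Write [u = U - U'], [v = V - V'], [z = |u||v|], [y = z - u.v] and
    [t = E(U.V)].  By normalization [E|U - V|^2 = 2 - 2t], so the left-hand
    side is [1 - t^2].  The two sides are compared through the squared norm of
    the wedge product, [|u|^2|v|^2 - (u.v)^2 = y (2z - y)].

    Lower bound ([wedge_norm_lower_bound]): [E(y (2z - y))] is at least
    [2 (1 - 1/d) (1 - t^2)].  By Lagrange's identity the integrand is half of
    the sum over [i, j] of [(u_i v_j - u_j v_i)^2], and
    [u_i v_j - u_j v_i = g(X) + g(X') - S] where [X = (U, V)],
    [g(X) = U_i V_j - U_j V_i], and [S] collects the products of a coordinate of
    [X] with a coordinate of [X'].  Each product in [S] is centered in both
    factors, hence [S] is orthogonal to every function of [X] alone or of [X']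
    alone, and the energy is at least [E S^2], a polynomial in the second
    moments of [X].  Isotropy of [U] and the Cauchy-Schwarz inequality
    [(tr C)^2 <= d |C|^2] for [C = E(U (x) V)] finish the computation.

    Only second moments of [X] are available a priori, and the orthogonality
    has to make sense: [iid_sum_sq_integrable] shows that if
    [g(X) + g(X')] is square integrable then so is [g(X)], so that either the
    energy is infinite or all cross terms are integrable ([iid_decoupling]).
    This covers the degenerate case where [E y = 0] multiplies an infinite
    moment.

    Upper bound ([defect_interpolation]): split
    [y (2z - y) = y^(1/(1+a)) (2z - y) * y^(a/(1+a))] and apply Hoelder with
    exponents [1 + a] and [(1 + a)/a].  The pointwise maximum of
    [y (2z - y)^(1+a)] over [0 <= y <= 2z] is [k_alpha^(1+a) z^(2+a)]
    ([k_alpha_bound]), and a second Hoelder inequality with exponents [p1] and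
    [p2] bounds [E z^(2+a)] by the two moments.  All of this holds in the
    extended reals. *)

(** * Products of functions of two i.i.d. variables *)

Section pairing.
Context (R : realType) (disp d1 d2 : measure_display)
  (T : measurableType disp) (E : measurableType d1) (F : measurableType d2).

Definition pair_mfun (X : {mfun T >-> E}) (Y : {mfun T >-> F}) :
    {mfun T >-> (E * F)%type} :=
  HB.pack (fun w => (X w, Y w))
    (isMeasurableFun.Build _ _ _ _ (fun w => (X w, Y w))
       (measurable_fun_pair (measurable_funPT X) (measurable_funPT Y))).
End pairing.

Section iid.
Local Open Scope ereal_scope.
Context (R : realType) (disp disp' : measure_display)
  (T : measurableType disp) (E : measurableType disp') (P : probability T R).
Variables X Xs : {mfun T >-> E}.
Hypothesis copy : iid_copy P X Xs.

Lemma iid_law A : measurable A -> pushforward P Xs A = pushforward P X A.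
Proof. by case: copy => + _ => /(_ A). Qed.

Lemma iid_joint_law (A : set (E * E)) : measurable A ->
  (distribution P X \x distribution P X) A
  = distribution P (pair_mfun X Xs) A.
Proof.
move=> mA; apply: product_measure_unique => // B C mB mC.
transitivity (P (X @^-1` B) * P (Xs @^-1` C)).
  by case: copy => _ /(_ B C mB mC).
by congr (_ * _); exact: iid_law.
Qed.

Lemma iid_joint_integral (h : E * E -> \bar R) :
  \int[distribution P (pair_mfun X Xs)]_z h z
  = \int[distribution P X \x distribution P X]_z h z.
Proof.
apply: eq_measure_integral => A mA _; apply/esym; exact: (iid_joint_law mA).
Qed.

Lemma iid_integral_ge0 (phi psi : E -> \bar R) :
  measurable_fun [set: E] phi -> measurable_fun [set: E] psi ->
  (forall x, 0 <= phi x) -> (forall x, 0 <= psi x) ->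
  \int[P]_w (phi (X w) * psi (Xs w))
  = \int[P]_w phi (X w) * \int[P]_w psi (X w).
Proof.
move=> mphi mpsi phi0 psi0.
pose XX := (pair_mfun X Xs).
pose h (z : E * E) := phi z.1 * psi z.2.
have mh : measurable_fun setT h.
  by apply: emeasurable_funM; exact: measurableT_comp.
have h0 z : 0 <= h z by rewrite mule_ge0.
transitivity (\int[distribution P XX]_z h z).
  by rewrite ge0_integral_distribution.
rewrite iid_joint_integral fubini_tonelli1// /fubini_F/=.
under eq_integral do rewrite /h/= ge0_integralZl//.
rewrite ge0_integralZr//; last by rewrite integral_ge0.
by rewrite !ge0_integral_distribution.
Qed.


Lemma iid_integrable (phi psi : E -> R) :
  measurable_fun [set: E] phi -> measurable_fun [set: E] psi ->
  P.-integrable setT (EFin \o (phi \o X)) ->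
  P.-integrable setT (EFin \o (psi \o X)) ->
  P.-integrable setT (fun w => (phi (X w) * psi (Xs w))%:E).
Proof.
move=> mphi mpsi iphi ipsi; apply/integrableP; split.
  apply/measurable_EFinP; apply: measurable_funM; exact: measurableT_comp.
under eq_integral do rewrite abse_EFin normrM EFinM.
rewrite (iid_integral_ge0 (phi := fun x => `|phi x|%:E)
  (psi := fun x => `|psi x|%:E))//.
- rewrite lte_mul_pinfty ?integral_ge0//.
  + rewrite ge0_fin_numE ?integral_ge0//.
    by case/integrableP : iphi.
  + by case/integrableP : ipsi.
- by apply/measurable_EFinP; exact: measurableT_comp.
- by apply/measurable_EFinP; exact: measurableT_comp.
Qed.

Lemma iid_Rintegral (phi psi : E -> R) :
  measurable_fun [set: E] phi -> measurable_fun [set: E] psi ->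
  P.-integrable setT (EFin \o (phi \o X)) ->
  P.-integrable setT (EFin \o (psi \o X)) ->
  (\int[P]_w (phi (X w) * psi (Xs w)) =
   (\int[P]_w phi (X w)) * (\int[P]_w psi (X w)))%R.
Proof.
move=> mphi mpsi iphi ipsi.
pose h (z : E * E) := (phi z.1 * psi z.2)%:E.
have mh : measurable_fun setT h.
  by apply/measurable_EFinP; apply: measurable_funM; exact: measurableT_comp.
have ih := iid_integrable mphi mpsi iphi ipsi.
have ih' : (distribution P X \x distribution P X).-integrable setT h.
  apply/integrableP; split => //; rewrite -iid_joint_integral.
  rewrite ge0_integral_distribution//; last exact: measurableT_comp.
  by case/integrableP : ih.
rewrite /Rintegral.
transitivity (fine (\int[distribution P (pair_mfun X Xs)]_z h z)).
  by rewrite integral_distribution.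
rewrite iid_joint_integral -integral12_prod_meas1// /fubini_F/=.
have pushed f : measurable_fun [set: E] f -> P.-integrable setT (EFin \o (f \o X)) ->
    (distribution P X).-integrable setT (EFin \o f).
  move=> mf ifX; apply: integrable_pushforward => //.
  exact/measurable_EFinP.
have mean f : measurable_fun [set: E] f -> P.-integrable setT (EFin \o (f \o X)) ->
    \int[distribution P X]_x (f x)%:E = (\int[P]_w f (X w))%:E.
  move=> mf ifX; rewrite integral_distribution//; last exact/measurable_EFinP.
  by rewrite /Rintegral fineK//; exact: integrable_fin_num.
transitivity (fine (\int[distribution P X]_x ((phi x)%:E * (\int[P]_w psi (X w))%:E))).
  congr fine; apply: eq_integral => x _.
  by rewrite -mean// -integralZl//; exact: pushed.
by rewrite integralZr// ?mean//; exact: pushed.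
Qed.
End iid.

(** * Orthogonality of one-variable functions and centered products *)

Section integrable_sums.
Context (R : realType) (disp : measure_display)
  (T : measurableType disp) (P : probability T R).
Implicit Types f g : T -> R.

Lemma integrable_mul_sq f g :
  measurable_fun [set: T] f -> measurable_fun [set: T] g ->
  P.-integrable setT (fun w => (f w ^+ 2)%:E) ->
  P.-integrable setT (fun w => (g w ^+ 2)%:E) ->
  P.-integrable setT (fun w => (f w * g w)%:E).
Proof.
move=> mf mg if2 ig2.
apply: (@le_integrable _ _ _ _ _ _ _ (fun w => (f w ^+ 2 + g w ^+ 2)%:E)) => //.
- by apply/measurable_EFinP; exact: measurable_funM.
- move=> w _ /=; rewrite lee_fin [leRHS]ger0_norm ?addr_ge0 ?sqr_ge0//.
  rewrite normrM -(real_normK (num_real (f w))) -(real_normK (num_real (g w))).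
  have := sqr_ge0 (`|f w| - `|g w|).
  have := mulr_ge0 (normr_ge0 (f w)) (normr_ge0 (g w)).
  by lra.
- by under eq_fun do rewrite EFinD; exact: integrableD.
Qed.

Lemma integrable_scale (k : R) f :
  P.-integrable setT (EFin \o f) -> P.-integrable setT (fun w => (k * f w)%:E).
Proof. by move=> fi; under eq_fun do rewrite EFinM; exact: integrableZl. Qed.

Lemma integrable_bigsum I (s : seq I) (f : I -> T -> R) :
  (forall i, P.-integrable setT (EFin \o f i)) ->
  P.-integrable setT (fun w => (\sum_(i <- s) f i w)%:E).
Proof.
move=> fi; under eq_fun do rewrite -sumEFin.
by apply: integrable_sum => // i _; exact: fi.
Qed.

Lemma Rintegral_bigsum I (s : seq I) (f : I -> T -> R) :
  (forall i, P.-integrable setT (EFin \o f i)) ->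
  \int[P]_w (\sum_(i <- s) f i w) = \sum_(i <- s) \int[P]_w f i w.
Proof.
move=> fi; elim: s => [|i s ih].
  by rewrite big_nil; under eq_Rintegral do rewrite big_nil;
     rewrite Rintegral_cst// mul0r.
rewrite big_cons -ih -RintegralD//; last exact: integrable_bigsum.
by apply: eq_Rintegral => w _; rewrite big_cons.
Qed.

End integrable_sums.

Section decoupling.
Context (R : realType) (disp disp' : measure_display)
  (T : measurableType disp) (E : measurableType disp') (P : probability T R).
Variables X Xs : {mfun T >-> E}.
Hypothesis copy : iid_copy P X Xs.

(** With [x = g(X)] and [y = g(X')], [x^2 <= 2 (x + y)^2 + 2 y^2]; multiplying
    by the weight [h(X')], [h = exp(-g^2)], turns the right-hand side into an
    integrable function since [h <= 1] and [g^2 h <= 1].  By independence the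
    left-hand side then has mean [E(g(X)^2) E(h(X))], and [E(h(X)) > 0] because
    [h] vanishes nowhere. *)
Lemma iid_sum_sq_integrable (g : E -> R) : measurable_fun [set: E] g ->
  P.-integrable setT (fun w => ((g (X w) + g (Xs w)) ^+ 2)%:E) ->
  P.-integrable setT (fun w => (g (X w) ^+ 2)%:E).
Proof.
move=> mg iG.
pose h x := expR (- g x ^+ 2).
have h_gt0 x : 0 < h x by exact: expR_gt0.
have h_le1 x : h x <= 1 by rewrite -expR0 ler_expR oppr_le0 sqr_ge0.
have gh_le1 x : g x ^+ 2 * h x <= 1.
  rewrite /h expRN ler_pdivrMr ?expR_gt0// mul1r.
  by apply: le_trans (expR_ge1Dx _); rewrite lerDr.
have mg2 : measurable_fun [set: E] (fun x => g x ^+ 2) by exact: measurable_funX.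
have mh : measurable_fun [set: E] h.
  by apply: measurableT_comp => //; exact: measurableT_comp.
have hint : (0 < \int[P]_w (h (X w))%:E)%E.
  rewrite lt_neqAle integral_ge0 ?andbT; last first.
    by move=> w _; rewrite lee_fin ltW.
  apply/eqP => e.
  have mhX : measurable_fun [set: T] (fun w => (h (X w))%:E).
    by apply/measurable_EFinP; exact: measurableT_comp.
  have : (\int[P]_w `|(h (X w))%:E| = 0)%E.
    by rewrite e; apply: eq_integral => w _; rewrite gee0_abs// lee_fin ltW.
  move/(ae_eq_integral_abs P measurableT mhX) => [N [mN PN0 TN]].
  have NT : N = setT.
    apply/seteqP; split => // w _; apply: TN => /= /(_ I) [] /eqP.
    by rewrite gt_eqF.
  by have := @probability_setT _ _ _ P; rewrite -NT PN0 => /eqP; rewrite eqe eq_sym oner_eq0.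
have prod_fin : (\int[P]_w (g (X w) ^+ 2)%:E * \int[P]_w (h (X w))%:E < +oo)%E.
  rewrite -(iid_integral_ge0 copy (phi := fun x => (g x ^+ 2)%:E)
     (psi := fun x => (h x)%:E)); last first.
  - by move=> x; rewrite lee_fin ltW.
  - by move=> x; rewrite lee_fin sqr_ge0.
  - exact/measurable_EFinP.
  - exact/measurable_EFinP.
  have i2 : P.-integrable setT (fun w => (2%:E * ((g (X w) + g (Xs w)) ^+ 2)%:E + 2%:E)%E).
    apply: integrableD => //; first exact: integrableZl.
    exact: finite_measure_integrable_cst.
  apply: le_lt_trans (integrable_lty measurableT i2).
  apply: ge0_le_integral => //.
  - by move=> w _; rewrite -EFinM lee_fin mulr_ge0 ?sqr_ge0// ltW.
  - apply/measurable_EFinP; apply: measurable_funM.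
      exact: (measurableT_comp mg2).
    exact: (measurableT_comp mh).
  - by case/integrableP : i2.
  - move=> w _; rewrite -!EFinM -EFinD lee_fin.
    have := gh_le1 (Xs w); have := h_le1 (Xs w); have := h_gt0 (Xs w).
    set p := h _; set x := g (X w); set y := g (Xs w) => p0 p1 yp.
    have := mulr_ge0 (sqr_ge0 (x + y + y)) (ltW p0).
    have := mulr_ge0 (sqr_ge0 (x + y)) (_ : 0 <= 1 - p).
    rewrite subr_ge0 => /(_ p1).
    by nra.
apply/integrableP; split.
  by apply/measurable_EFinP; apply: (measurableT_comp mg2).
under eq_integral do rewrite gee0_abs ?lee_fin ?sqr_ge0//.
rewrite ltey; apply/eqP => e.
by move: prod_fin; rewrite e gt0_mulye.
Qed.


Section bilinear_form.
Variables (n : nat) (c : 'I_n -> R) (phi psi : 'I_n -> E -> R).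
Hypothesis mphi : forall k, measurable_fun [set: E] (phi k).
Hypothesis mpsi : forall k, measurable_fun [set: E] (psi k).
Hypothesis phi2 : forall k, P.-integrable setT (fun w => (phi k (X w) ^+ 2)%:E).
Hypothesis psi2 : forall k, P.-integrable setT (fun w => (psi k (X w) ^+ 2)%:E).

Let S w := \sum_(k < n) c k * (phi k (X w) * psi k (Xs w)).

Lemma bilinear_sqE w : S w ^+ 2 = \sum_(k < n) \sum_(l < n) c k * c l *
  (phi k (X w) * phi l (X w) * (psi k (Xs w) * psi l (Xs w))).
Proof.
rewrite expr2 mulr_suml; apply: eq_bigr => k _.
by rewrite mulr_sumr; apply: eq_bigr => l _; ring.
Qed.

Let iphi k l : P.-integrable setT (fun w => (phi k (X w) * phi l (X w))%:E).
Proof. by apply: integrable_mul_sq => //; exact: measurableT_comp. Qed.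

Let ipsi k l : P.-integrable setT (fun w => (psi k (X w) * psi l (X w))%:E).
Proof. by apply: integrable_mul_sq => //; exact: measurableT_comp. Qed.

Let iterm k l : P.-integrable setT
  (EFin \o (fun w => c k * c l *
    (phi k (X w) * phi l (X w) * (psi k (Xs w) * psi l (Xs w))))).
Proof.
apply: integrable_scale.
apply: (@iid_integrable _ _ _ _ _ _ _ _ copy (fun x => phi k x * phi l x)
  (fun x => psi k x * psi l x)).
- exact: measurable_funM.
- exact: measurable_funM.
- exact: iphi.
- exact: ipsi.
Qed.

Lemma integrable_bilinear_sq : P.-integrable setT (fun w => (S w ^+ 2)%:E).
Proof.
under eq_fun do rewrite bilinear_sqE.
by apply: integrable_bigsum => k; exact: integrable_bigsum.
Qed.

Lemma Rintegral_bilinear_sq : \int[P]_w (S w ^+ 2) =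
  \sum_(k < n) \sum_(l < n) c k * c l *
   ((\int[P]_w (phi k (X w) * phi l (X w))) *
    (\int[P]_w (psi k (X w) * psi l (X w)))).
Proof.
under eq_Rintegral do rewrite bilinear_sqE.
rewrite Rintegral_bigsum; last by move=> k; exact: integrable_bigsum.
apply: eq_bigr => k _; rewrite Rintegral_bigsum//; apply: eq_bigr => l _.
have mphi2 : measurable_fun [set: E] (fun x => phi k x * phi l x).
  exact: measurable_funM.
have mpsi2 : measurable_fun [set: E] (fun x => psi k x * psi l x).
  exact: measurable_funM.
rewrite RintegralZl//; last first.
  exact: (@iid_integrable _ _ _ _ _ _ _ _ copy (fun x => phi k x * phi l x)
    (fun x => psi k x * psi l x) mphi2 mpsi2 (iphi k l) (ipsi k l)).
by rewrite (@iid_Rintegral _ _ _ _ _ _ _ _ copy (fun x => phi k x * phi l x)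
    (fun x => psi k x * psi l x) mphi2 mpsi2 (iphi k l) (ipsi k l)).
Qed.

Hypothesis phi0 : forall k, \int[P]_w phi k (X w) = 0.
Hypothesis psi0 : forall k, \int[P]_w psi k (X w) = 0.

(** If the right-hand side is finite, then [g(X) + g(X')] and hence [g(X)] are
    square integrable; the products of [S] with [g(X)] and with [g(X')] then
    have mean zero, as in each term one of the two independent factors is a
    centered [phi k] or [psi k].  The inequality follows by integrating
    [S^2 - 2 (g(X) + g(X')) S <= (g(X) + g(X') - S)^2]. *)
Lemma iid_decoupling (g : E -> R) : measurable_fun [set: E] g ->
  ((\sum_(k < n) \sum_(l < n) c k * c l *
   ((\int[P]_w (phi k (X w) * phi l (X w))) *
    (\int[P]_w (psi k (X w) * psi l (X w)))))%:E
  <= \int[P]_w ((g (X w) + g (Xs w) - S w) ^+ 2)%:E)%E.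
Proof.
move=> mg; rewrite -Rintegral_bilinear_sq.
have mS : measurable_fun [set: T] S.
  apply: measurable_sum => k; apply: measurable_funM => //.
  by apply: measurable_funM; exact: measurableT_comp.
have mG : measurable_fun [set: T] (fun w => g (X w) + g (Xs w)).
  by apply: measurable_funD; exact: measurableT_comp.
have mGS : measurable_fun [set: T] (fun w => g (X w) + g (Xs w) - S w).
  exact: measurable_funB.
have [W_fin|] := ltP (\int[P]_w ((g (X w) + g (Xs w) - S w) ^+ 2)%:E)%E +oo%E; last first.
  by rewrite leye_eq => /eqP ->; rewrite leey.
have iW : P.-integrable setT (fun w => ((g (X w) + g (Xs w) - S w) ^+ 2)%:E).
  apply/integrableP; split; first by apply/measurable_EFinP; exact: measurable_funX.
  by under eq_integral do rewrite gee0_abs ?lee_fin ?sqr_ge0//.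
have iS := integrable_bilinear_sq.
have ig : P.-integrable setT (fun w => (g (X w) ^+ 2)%:E).
  apply: iid_sum_sq_integrable => //.
  apply: (@le_integrable _ _ _ _ _ _ _
    (fun w => (2 * (g (X w) + g (Xs w) - S w) ^+ 2 + 2 * S w ^+ 2)%:E)) => //.
  - by apply/measurable_EFinP; exact: measurable_funX.
  - move=> w _; rewrite lee_fin [leLHS]ger0_norm ?sqr_ge0//.
    apply: le_trans (ler_norm _).
    set G := g _ + _; have := sqr_ge0 (G - S w - S w); by nra.
  - under eq_fun do rewrite EFinD.
    by apply: integrableD => //; apply: integrable_scale.
pose cross w := \sum_(k < n) c k * (g (X w) * phi k (X w) * psi k (Xs w)
   + phi k (X w) * (g (Xs w) * psi k (Xs w))).
have crossE w : cross w = (g (X w) + g (Xs w)) * S w.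
  by rewrite /cross /S mulr_sumr; apply: eq_bigr => k _; ring.
have L1 (f : E -> R) : measurable_fun [set: E] f ->
   P.-integrable setT (fun w => (f (X w) ^+ 2)%:E) ->
   P.-integrable setT (fun w => (f (X w))%:E).
  move=> mf if2.
  under eq_fun do rewrite -[f _]mulr1.
  apply: (integrable_mul_sq (g := cst 1)) => //; first exact: measurableT_comp.
  exact: (finite_measure_integrable_cst P (1 ^+ 2)).
have igphi k : P.-integrable setT (fun w => (g (X w) * phi k (X w))%:E).
  by apply: integrable_mul_sq => //; exact: measurableT_comp.
have igpsi k : P.-integrable setT (fun w => (g (X w) * psi k (X w))%:E).
  by apply: integrable_mul_sq => //; exact: measurableT_comp.
have mgphi k : measurable_fun [set: E] (fun x => g x * phi k x).
  exact: measurable_funM.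
have mgpsi k : measurable_fun [set: E] (fun x => g x * psi k x).
  exact: measurable_funM.
have i1 k := @iid_integrable _ _ _ _ _ _ _ _ copy _ _
  (mgphi k) (mpsi k) (igphi k) (L1 _ (mpsi k) (psi2 k)).
have i2 k := @iid_integrable _ _ _ _ _ _ _ _ copy _ _
  (mphi k) (mgpsi k) (L1 _ (mphi k) (phi2 k)) (igpsi k).
have e1 k := @iid_Rintegral _ _ _ _ _ _ _ _ copy _ _
  (mgphi k) (mpsi k) (igphi k) (L1 _ (mpsi k) (psi2 k)).
have e2 k := @iid_Rintegral _ _ _ _ _ _ _ _ copy _ _
  (mphi k) (mgpsi k) (L1 _ (mphi k) (phi2 k)) (igpsi k).
have i12 k : P.-integrable setT (fun w => (g (X w) * phi k (X w) * psi k (Xs w)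
   + phi k (X w) * (g (Xs w) * psi k (Xs w)))%:E).
  by under eq_fun do rewrite EFinD; exact: integrableD.
have icross : P.-integrable setT (fun w => (cross w)%:E).
  by apply: integrable_bigsum => k; exact: (integrable_scale _ (i12 k)).
have cross0 : \int[P]_w cross w = 0.
  rewrite Rintegral_bigsum; last by move=> k; exact: (integrable_scale _ (i12 k)).
  apply: big1 => k _; rewrite RintegralZl//; last exact: i12.
  rewrite RintegralD//; [|exact: i1|exact: i2].
  by rewrite e1 e2 psi0 phi0 mulr0 mul0r addr0 mulr0.
have eS : \int[P]_w (S w ^+ 2 - 2 * cross w) = \int[P]_w (S w ^+ 2).
  rewrite RintegralB//; last exact: (integrable_scale _ icross).
  by rewrite RintegralZl// cross0 mulr0 subr0.
rewrite -[X in (X%:E <= _)%E]eS.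
have idiff : P.-integrable setT (fun w => (S w ^+ 2 - 2 * cross w)%:E).
  by under eq_fun do rewrite EFinB; apply: integrableB => //;
    exact: (integrable_scale _ icross).
rewrite /Rintegral fineK; last exact: integrable_fin_num.
apply: le_integral => // w _; rewrite lee_fin crossE.
by have := sqr_ge0 (g (X w) + g (Xs w)); nra.
Qed.

End bilinear_form.
End decoupling.

(** * Lower bound for the energy of the wedge product *)

Lemma lagrange_identity (R : realType) (d : nat) (u v : d.-tuple R) :
  \sum_(i < d) \sum_(j < d) (tnth u i * tnth v j - tnth u j * tnth v i) ^+ 2
  = 2 * (dot u u * dot v v - dot u v ^+ 2).
Proof.
rewrite mulrBr expr2 /dot !big_distrlr/= !pair_big/=.
rewrite (eq_bigr (fun p : 'I_d * 'I_d =>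
  tnth u p.1 * tnth u p.1 * (tnth v p.2 * tnth v p.2)
  + tnth v p.1 * tnth v p.1 * (tnth u p.2 * tnth u p.2)
  - 2 * (tnth u p.1 * tnth v p.1 * (tnth u p.2 * tnth v p.2)))); last first.
  by move=> p _; ring.
rewrite sumrB big_split/= -mulr_sumr.
have -> : \sum_p tnth v p.1 * tnth v p.1 * (tnth u p.2 * tnth u p.2)
  = \sum_(p : 'I_d * 'I_d) tnth u p.1 * tnth u p.1 * (tnth v p.2 * tnth v p.2).
  rewrite (reindex_inj (h := fun p => (p.2, p.1))) => [|[i j] [k l] [-> ->]//].
  by apply: eq_bigr => p _ /=; rewrite mulrC.
by ring.
Qed.

Section wedge.
Context (R : realType) (disp : measure_display)
  (T : measurableType disp) (P : probability T R) (d : nat).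
Variables U V Us Vs : {RV P >-> d.-tuple R}.
Hypothesis copy : iid_copy P (fun w => (U w, V w)) (fun w => (Us w, Vs w)).
Hypothesis U2 : forall i, P.-integrable setT (fun w => (tnth (U w) i ^+ 2)%:E).
Hypothesis V2 : forall i, P.-integrable setT (fun w => (tnth (V w) i ^+ 2)%:E).
Hypothesis U0 : forall i, \int[P]_w tnth (U w) i = 0.
Hypothesis V0 : forall i, \int[P]_w tnth (V w) i = 0.

Let A i j := \int[P]_w (tnth (U w) i * tnth (U w) j).
Let B i j := \int[P]_w (tnth (V w) i * tnth (V w) j).
Let C i j := \int[P]_w (tnth (U w) i * tnth (V w) j).

(** The right-hand side has the form treated by [iid_decoupling], with
    [g = U_i V_j - U_j V_i] and
    [S = U_i V'_j + V_j U'_i - U_j V'_i - V_i U'_j]; the left-hand side is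
    [E S^2] expanded in second moments. *)
Lemma wedge_energy i j :
  ((2 * (A i i * B j j + A j j * B i i - 2 * (A i j * B i j))
    + 2 * (C i j ^+ 2 + C j i ^+ 2 - 2 * (C i i * C j j)))%:E <=
  \int[P]_w ((tnth (vsub (U w) (Us w)) i * tnth (vsub (V w) (Vs w)) j
            - tnth (vsub (U w) (Us w)) j * tnth (vsub (V w) (Vs w)) i) ^+ 2)%:E)%E.
Proof.
pose fst_ i (x : d.-tuple R * d.-tuple R) := tnth x.1 i.
pose snd_ i (x : d.-tuple R * d.-tuple R) := tnth x.2 i.
have mfst k : measurable_fun setT (fst_ k).
  exact: (measurableT_comp (measurable_tnth k)).
have msnd k : measurable_fun setT (snd_ k).
  exact: (measurableT_comp (measurable_tnth k)).
pose c (k : 'I_4) : R := nth 0 [:: 1; 1; -1; -1] k.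
pose phi (k : 'I_4) := nth (fst_ i) [:: fst_ i; snd_ j; fst_ j; snd_ i] k.
pose psi (k : 'I_4) := nth (fst_ i) [:: snd_ j; fst_ i; snd_ i; fst_ j] k.
pose g x := fst_ i x * snd_ j x - fst_ j x * snd_ i x.
have mphi k : measurable_fun setT (phi k).
  by rewrite /phi /psi; case: k => -[|[|[|[|?]]]] /=.
have mpsi k : measurable_fun setT (psi k).
  by rewrite /phi /psi; case: k => -[|[|[|[|?]]]] /=.
have mg : measurable_fun setT g.
  by apply: measurable_funB; exact: measurable_funM.
have := @iid_decoupling _ _ _ _ _ P (pair_mfun U V) (pair_mfun Us Vs) copy
  4 c phi psi mphi mpsi _ _ _ _ g mg.
have e : \sum_(k < 4) \sum_(l < 4) c k * c l *
   ((\int[P]_w (phi k (pair_mfun U V w) * phi l (pair_mfun U V w)))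
   * (\int[P]_w (psi k (pair_mfun U V w) * psi l (pair_mfun U V w)))) =
   (2 * (A i i * B j j + A j j * B i i - 2 * (A i j * B i j))
    + 2 * (C i j ^+ 2 + C j i ^+ 2 - 2 * (C i i * C j j))).
  rewrite !big_ord_recl !big_ord0 /c /phi /psi /=.
  have FF a b : \int[P]_w (fst_ a (U w, V w) * fst_ b (U w, V w)) = A a b by [].
  have SS a b : \int[P]_w (snd_ a (U w, V w) * snd_ b (U w, V w)) = B a b by [].
  have FS a b : \int[P]_w (fst_ a (U w, V w) * snd_ b (U w, V w)) = C a b by [].
  have SF a b : \int[P]_w (snd_ a (U w, V w) * fst_ b (U w, V w)) = C b a.
    by rewrite -FS; apply: eq_Rintegral => w _; rewrite mulrC.
  have AC a b : A a b = A b a by apply: eq_Rintegral => w _; rewrite mulrC.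
  have BC a b : B a b = B b a by apply: eq_Rintegral => w _; rewrite mulrC.
  rewrite !FF !SS !FS !SF (AC j i) (BC j i).
  by ring.
rewrite e => le_energy.
rewrite (_ : (\int[P]_w _)%E = \int[P]_w ((g (pair_mfun U V w) + g (pair_mfun Us Vs w)
  - \sum_(k < 4) c k * (phi k (pair_mfun U V w) * psi k (pair_mfun Us Vs w))) ^+ 2)%:E)%E.
  by apply: le_energy => k; rewrite /phi /psi;
    case: k => -[|[|[|[|?]]]] //= _; rewrite ?U0 ?V0//; by [exact: U2|exact: V2].
apply: eq_integral => w _; congr (_ ^+ 2)%:E.
rewrite !big_ord_recl !big_ord0 /c /phi /psi /g /fst_ /snd_ /= !tnth_mktuple.
by ring.
Qed.

Hypothesis isotropicU : forall i j, A i j = (i == j)%:R / d%:R.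
Hypothesis normalizedV : \sum_(i < d) B i i = 1.
Hypothesis d_gt0 : (0 < d)%N.

(** The sum equals [4 (1 - 1/d) + 4 (|C|^2 - t^2)], where [|C|] is the
    Frobenius norm, and [|C|^2 >= t^2 / d] as [t] is the trace of [C]. *)
Lemma sum_wedge_energy (t : R) : t = \sum_(i < d) C i i ->
  4 * (1 - d%:R^-1) * (1 - t ^+ 2) <=
  \sum_(i < d) \sum_(j < d)
   (2 * (A i i * B j j + A j j * B i i - 2 * (A i j * B i j))
    + 2 * (C i j ^+ 2 + C j i ^+ 2 - 2 * (C i i * C j j))).
Proof.
move=> tE.
have d0 : (d%:R : R) != 0 by rewrite pnatr_eq0 -lt0n.
have trA : \sum_(i < d) A i i = 1.
  under eq_bigr do rewrite isotropicU eqxx.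
  by rewrite sumr_const card_ord -[LHS]mulr_natr divfK.
have AB : \sum_(i < d) \sum_(j < d) A i j * B i j = d%:R^-1.
  transitivity (d%:R^-1 * \sum_(i < d) B i i); last by rewrite normalizedV mulr1.
  rewrite mulr_sumr; apply: eq_bigr => i _.
  rewrite (bigD1 i)//= big1 ?addr0; last first.
    by move=> j /negPf ji; rewrite isotropicU eq_sym ji mul0r mul0r.
  by rewrite isotropicU eqxx mulr1n mul1r.
pose N := \sum_(i < d) \sum_(j < d) C i j ^+ 2.
have diagN : \sum_(i < d) C i i ^+ 2 <= N.
  apply: ler_sum => i _; rewrite (bigD1 i)//= lerDl.
  by apply: sumr_ge0 => j _; exact: sqr_ge0.
have tN : t ^+ 2 / d%:R <= N.
  apply: le_trans diagN.
  (* Cauchy-Schwarz as the nonnegativity of the variance of the diagonal *)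
  have : 0 <= \sum_(i < d) (C i i - t / d%:R) ^+ 2.
    by apply: sumr_ge0 => i _; exact: sqr_ge0.
  rewrite (eq_bigr (fun i => C i i ^+ 2 - 2 * (t / d%:R) * C i i + (t / d%:R) ^+ 2)); last first.
    by move=> i _; ring.
  rewrite big_split sumrB/= -mulr_sumr -tE sumr_const card_ord -mulr_natr.
  move=> sq_ge0; rewrite -subr_ge0; apply: (le_trans sq_ge0).
  by rewrite le_eqVlt; apply/orP; left; apply/eqP; field.
have AB1 : \sum_(p : 'I_d * 'I_d) A p.1 p.1 * B p.2 p.2 = 1.
  by rewrite -(pair_bigA _ (fun i j => A i i * B j j)) -big_distrlr/= trA normalizedV mulr1.
have swap (F : 'I_d * 'I_d -> R) : \sum_p F (p.2, p.1) = \sum_p F p.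
  by rewrite [RHS](reindex_inj (h := fun p => (p.2, p.1))) => [|[i j] [k l] [-> ->]//].
have AB2 : \sum_(p : 'I_d * 'I_d) A p.2 p.2 * B p.1 p.1 = 1.
  by rewrite (swap (fun p => A p.1 p.1 * B p.2 p.2)).
have N' : \sum_(p : 'I_d * 'I_d) C p.2 p.1 ^+ 2 = N.
  by rewrite (swap (fun p => C p.1 p.2 ^+ 2)) /N pair_big.
have CC : \sum_(p : 'I_d * 'I_d) C p.1 p.1 * C p.2 p.2 = t ^+ 2.
  by rewrite -(pair_bigA _ (fun i j => C i i * C j j)) -big_distrlr/= -tE.
rewrite pair_big/= big_split/= -!mulr_sumr !sumrB !big_split/= -!mulr_sumr.
rewrite AB1 AB2 N' CC -(pair_bigA _ (fun i j => A i j * B i j)) AB.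
rewrite -(pair_bigA _ (fun i j => C i j ^+ 2)) -/N.
have : 0 <= N - t ^+ 2 / d%:R by rewrite subr_ge0.
by lra.
Qed.


Lemma wedge_norm_lower_bound (t : R) : t = \sum_(i < d) C i i ->
  ((2 * (1 - d%:R^-1) * (1 - t ^+ 2))%:E <=
  \int[P]_w (dot (vsub (U w) (Us w)) (vsub (U w) (Us w)) *
              dot (vsub (V w) (Vs w)) (vsub (V w) (Vs w))
            - dot (vsub (U w) (Us w)) (vsub (V w) (Vs w)) ^+ 2)%:E)%E.
Proof.
move=> tE.
have mtnth (X : {RV P >-> d.-tuple R}) i : measurable_fun [set: T] (fun w => tnth (X w) i).
  exact: (measurableT_comp (measurable_tnth i)).
pose W i j w := tnth (vsub (U w) (Us w)) i * tnth (vsub (V w) (Vs w)) j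
            - tnth (vsub (U w) (Us w)) j * tnth (vsub (V w) (Vs w)) i.
have mW i j : measurable_fun [set: T] (fun w => (W i j w ^+ 2)%:E).
  apply/measurable_EFinP; apply: measurable_funX; rewrite /W.
  under eq_fun do rewrite !tnth_mktuple.
  by apply: measurable_funB; apply: measurable_funM; apply: measurable_funB; exact: mtnth.
have W0 i j w : (0 <= (W i j w ^+ 2)%:E)%E by rewrite lee_fin sqr_ge0.
rewrite (eq_integral (fun w => 2^-1%:E *
    \sum_(i < d) \sum_(j < d) (W i j w ^+ 2)%:E)%E); last first.
  move=> w _; under eq_bigr do rewrite sumEFin.
  by rewrite sumEFin -EFinM lagrange_identity mulKf.
rewrite ge0_integralZl//; last 2 first.
- by apply: emeasurable_sum => i; exact: emeasurable_sum.
- by move=> w _; apply: sume_ge0 => i _; exact: sume_ge0.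
rewrite ge0_integral_sum//; last 2 first.
- by move=> i; exact: emeasurable_sum.
- by move=> i w _; exact: sume_ge0.
rewrite (_ : 2 * (1 - d%:R^-1) * (1 - t ^+ 2) = 2^-1 * (4 * (1 - d%:R^-1) * (1 - t ^+ 2))); last first.
  by field; rewrite pnatr_eq0 -lt0n.
rewrite EFinM lee_wpmul2l//.
apply: le_trans (_ : (\sum_(i < d) \sum_(j < d)
   (2 * (A i i * B j j + A j j * B i i - 2 * (A i j * B i j))
    + 2 * (C i j ^+ 2 + C j i ^+ 2 - 2 * (C i i * C j j)))%:E <= _)%E).
  under eq_bigr do rewrite sumEFin.
  by rewrite sumEFin lee_fin; exact: sum_wedge_energy.
apply: lee_sum => i _; rewrite ge0_integral_sum//.
by apply: lee_sum => j _; exact: wedge_energy.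
Qed.

End wedge.

(** * Interpolation of the defect *)

Lemma hoelder_ge0 (R : realType) (disp : measure_display)
    (T : measurableType disp) (mu : {measure set T -> \bar R})
    (f g : T -> R) (p q : R) :
  measurable_fun [set: T] f -> measurable_fun [set: T] g ->
  (forall w, 0 <= f w) -> (forall w, 0 <= g w) ->
  0 < p -> 0 < q -> p^-1 + q^-1 = 1 ->
  (\int[mu]_w (f w * g w)%:E <=
   (\int[mu]_w (f w `^ p)%:E) `^ p^-1 * (\int[mu]_w (g w `^ q)%:E) `^ q^-1)%E.
Proof.
move=> mf mg f0 g0 p0 q0 pq.
have := hoelder mu mf mg p0 q0 pq; rewrite Lnorm1 unlock.
congr (_ <= _ `^ _ * _ `^ _)%E; apply: eq_integral => w _ /=;
  by rewrite ger0_norm// mulr_ge0.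
Qed.

Lemma k_alpha_ge0 (R : realType) (a : R) : 0 < a -> 0 <= k_alpha a.
Proof. by move=> a0; rewrite mulr_ge0 ?powR_ge0// addr_ge0// ltW. Qed.

(** Weighted AM-GM applied to [(1+a) y] with weight [1/(2+a)] and to [2z - y]
    with weight [(1+a)/(2+a)]: these weights make the arithmetic mean
    [(1+a)/(2+a) * 2z] independent of [y]. *)
Lemma k_alpha_bound (R : realType) (a y z : R) : 0 < a -> 0 <= y <= 2 * z ->
  y * (2 * z - y) `^ (1 + a) <= k_alpha a `^ (1 + a) * z `^ (2 + a).
Proof.
move=> a0 /andP[y0 yz].
have b0 : 0 <= 2 * z - y by rewrite subr_ge0.
have z0 : 0 <= z by lra.
have a1 : 0 < 1 + a by lra.
have a2 : 0 < 2 + a by lra.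
have a1n : 1 + a != 0 by rewrite gt_eqF.
have a2n : 2 + a != 0 by rewrite gt_eqF.
set b := 2 * z - y in b0 *.
have y1 : 0 <= (1 + a) * y by rewrite mulr_ge0// ltW.
have pq : (2 + a)^-1 + ((2 + a) / (1 + a))^-1 = 1 by field; rewrite ?a1n ?a2n.
have young := conjugate_powR (powR_ge0 ((1 + a) * y) (2 + a)^-1)
  (powR_ge0 b ((1 + a) / (2 + a))) a2 (divr_gt0 a2 a1) pq.
rewrite -!powRrM mulVf// in young.
rewrite (_ : (1 + a) / (2 + a) * ((2 + a) / (1 + a)) = 1) in young; last first.
  by field; rewrite ?a1n ?a2n.
rewrite !powRr1// in young.
rewrite (_ : (1 + a) * y / (2 + a) + b / ((2 + a) / (1 + a))
   = (1 + a) * (2 / (2 + a)) * z) in young; last first.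
  by rewrite /b; field; rewrite ?a1n ?a2n.
have c0 : 0 <= 2 / (2 + a) by rewrite divr_ge0// ltW.
have a10 := ltW a1.
have ac0 : 0 <= (1 + a) * (2 / (2 + a)) by rewrite mulr_ge0.
have := ge0_ler_powR (ltW a2) (mulr_ge0 (powR_ge0 _ _) (powR_ge0 _ _))
  (mulr_ge0 ac0 z0) young.
rewrite (powRM _ (powR_ge0 _ _) (powR_ge0 _ _)) -!powRrM mulVf// divfK// powRr1//.
rewrite (powRM _ ac0 z0) (powRM _ a10 c0).
have -> : (1 + a) `^ (2 + a) = (1 + a) * (1 + a) `^ (1 + a).
  rewrite -[X in X * _](powRr1 a10) -powRD; last by rewrite a1n implybT.
  by congr (_ `^ _); ring.
rewrite -!mulrA ler_pM2l// => le_pow; apply: le_trans le_pow _.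
rewrite /k_alpha (powRM _ a10 (powR_ge0 _ _)) -powRrM divfK//.
by rewrite -!mulrA.
Qed.

(** The factor [y^(1/(1+a))] left next to [2z - y] is the one that makes its
    power [1+a] equal to the quantity bounded in [k_alpha_bound]. *)
Lemma defect_interpolation (R : realType) (disp : measure_display)
    (T : measurableType disp) (mu : {measure set T -> \bar R})
    (y z : T -> R) (a : R) :
  measurable_fun [set: T] y -> measurable_fun [set: T] z ->
  (forall w, 0 <= y w <= 2 * z w) -> 0 < a ->
  (\int[mu]_w (y w * (2 * z w - y w))%:E <=
   (k_alpha a)%:E * (\int[mu]_w (z w `^ (2 + a))%:E) `^ (1 + a)^-1
   * (\int[mu]_w (y w)%:E) `^ (a / (1 + a)))%E.
Proof.
move=> my mz yz a0.
have a1 : 0 < 1 + a by lra.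
have a1n : 1 + a != 0 by rewrite gt_eqF.
have a0n : a != 0 by rewrite gt_eqF.
have y0 w : 0 <= y w by case/andP: (yz w).
have b0 w : 0 <= 2 * z w - y w by rewrite subr_ge0; case/andP: (yz w).
have mb : measurable_fun [set: T] (fun w => 2 * z w - y w).
  by apply: measurable_funB => //; exact: measurable_funM.
have mpow (h : T -> R) r : measurable_fun [set: T] h ->
    measurable_fun [set: T] (fun w => h w `^ r).
  by move=> mh; exact: (measurableT_comp (measurable_powR r)).
pose F w := y w `^ (1 + a)^-1 * (2 * z w - y w).
pose G w := y w `^ (a / (1 + a)).
have split_exp w : y w * (2 * z w - y w) = F w * G w.
  have e1 : (1 + a)^-1 + a / (1 + a) = 1 by field; rewrite ?a1n.
  have side : ((1 + a)^-1 + a / (1 + a) == 0) ==> (y w != 0).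
    by rewrite e1 oner_eq0.
  by rewrite /F /G mulrAC -(powRD side) e1 powRr1.
have mF : measurable_fun [set: T] F by apply: measurable_funM => //; exact: mpow.
under eq_integral do rewrite split_exp.
have F0 w : 0 <= F w by rewrite mulr_ge0 ?powR_ge0.
have G0 w : 0 <= G w by rewrite powR_ge0.
have pq : (1 + a)^-1 + ((1 + a) / a)^-1 = 1 by field; rewrite ?a0n ?a1n.
apply: le_trans (hoelder_ge0 mu mF (mpow _ _ my) F0 G0 a1 (divr_gt0 a1 a0) pq) _.
rewrite invf_div lee_pmul ?poweR_ge0//; last first.
  rewrite le_eqVlt; apply/orP; left; apply/eqP; congr (_ `^ _)%E.
  apply: eq_integral => w _; rewrite /G -powRrM.
  by rewrite (_ : _ * _ = 1) ?powRr1//; field; rewrite ?a0n ?a1n.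
have -> : (k_alpha a)%:E = ((k_alpha a `^ (1 + a))%:E `^ (1 + a)^-1)%E.
  by rewrite poweR_EFin -powRrM mulfV// powRr1// k_alpha_ge0.
have z0 w : (0 <= (z w `^ (2 + a))%:E)%E by rewrite lee_fin powR_ge0.
rewrite -poweRM; [|by rewrite lee_fin powR_ge0|exact: integral_ge0].
have k0 : 0 <= k_alpha a `^ (1 + a) by rewrite powR_ge0.
rewrite -ge0_integralZl//; last by apply/measurable_EFinP; exact: mpow.
apply: gt0_ler_poweR.
- by rewrite invr_ge0 ltW.
- by rewrite in_itv/= leey andbT integral_ge0// => w _; rewrite lee_fin powR_ge0.
- by rewrite in_itv/= leey andbT integral_ge0// => w _; rewrite mule_ge0.
apply: ge0_le_integral => //.
- by move=> w _; rewrite lee_fin powR_ge0.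
- by apply/measurable_EFinP; exact: mpow.
- by apply/measurable_EFinP; apply: measurable_funM => //; exact: mpow.
move=> w _; rewrite -EFinM lee_fin /F powRM ?powR_ge0// -powRrM mulVf// powRr1//.
exact: k_alpha_bound.
Qed.

(** * The inequality *)

Lemma dot_ge0 (R : realType) (d : nat) (u : d.-tuple R) : 0 <= dot u u.
Proof. by apply: sumr_ge0 => i _; rewrite -expr2 sqr_ge0. Qed.

Lemma enorm_ge0 (R : realType) (d : nat) (u : d.-tuple R) : 0 <= enorm u.
Proof. exact: sqrtr_ge0. Qed.

Lemma sqr_enorm (R : realType) (d : nat) (u : d.-tuple R) : enorm u ^+ 2 = dot u u.
Proof. by rewrite sqr_sqrtr// dot_ge0. Qed.

Lemma cauchy_schwarz (R : realType) (d : nat) (u v : d.-tuple R) :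
  `|dot u v| <= enorm u * enorm v.
Proof.
rewrite -ler_sqr ?nnegrE ?mulr_ge0 ?enorm_ge0// exprMn !sqr_enorm.
rewrite real_normK ?num_real// -subr_ge0 -(pmulr_rge0 _ (ltr0Sn R 1)).
rewrite -lagrange_identity.
by apply: sumr_ge0 => i _; apply: sumr_ge0 => j _; exact: sqr_ge0.
Qed.

Theorem proposition2p8 (R : realType) (disp : measure_display)
    (T : measurableType disp) (P : probability T R) (d : nat)
    (U V Us Vs : {RV P >-> d.-tuple R}) (a p1 p2 : R)
    (hd : (2 <= d)%N)
    (centeredU : forall i : 'I_d, ('E_P[fun w => tnth (U w) i] = 0)%E)
    (centeredV : forall i : 'I_d, ('E_P[fun w => tnth (V w) i] = 0)%E)
    (normalizedU : ('E_P[fun w => (enorm (U w) ^+ 2)%R] = 1)%E)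
    (normalizedV : ('E_P[fun w => (enorm (V w) ^+ 2)%R] = 1)%E)
    (isotropicU : forall i j : 'I_d,
       ('E_P[fun w => (tnth (U w) i * tnth (U w) j)%R]
        = ((i == j)%:R / d%:R)%:E)%E)
    (copy : iid_copy P (fun w => (U w, V w)) (fun w => (Us w, Vs w)))
    (ha : 0 < a) (hp1 : 1 < p1) (hp2 : 1 < p2) (hp : p1^-1 + p2^-1 = 1) :
  ((f (fine 'E_P[fun w => (enorm (vsub (U w) (V w)) ^+ 2)%R]))%:E
   <= (k_alpha a * (d%:R / (d%:R - 1)))%:E
      * law_moment P U Us (p1 * (2 + a)) `^ ((2 + a) / (1 + a))
      * law_moment P V Vs (p2 * (2 + a)) `^ ((2 + a) / (1 + a))
      * 'E_P[fun w => (enorm (vsub (U w) (Us w)) * enorm (vsub (V w) (Vs w))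
                       - dot (vsub (U w) (Us w)) (vsub (V w) (Vs w)))%R]
          `^ (a / (1 + a)))%E.
Proof.
have mtnth (X : {RV P >-> d.-tuple R}) i : measurable_fun [set: T] (fun w => tnth (X w) i).
  exact: (measurableT_comp (measurable_tnth i)).
have coord2 (X : {RV P >-> d.-tuple R}) : ('E_P[fun w => (enorm (X w) ^+ 2)%R] = 1)%E ->
    forall i, P.-integrable setT (fun w => (tnth (X w) i ^+ 2)%:E).
  move=> EX i.
  have mX2 : measurable_fun [set: T] (fun w => (tnth (X w) i ^+ 2)%:E).
    by apply/measurable_EFinP; exact: measurable_funX.
  apply/integrableP; split => //.
  apply: (@le_lt_trans _ _ (1%E)); last exact: ltry.
  rewrite -EX unlock; apply: ge0_le_integral => //.
  - exact: measurableT_comp.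
  - apply/measurable_EFinP; under eq_fun do rewrite sqr_enorm.
    by apply: measurable_sum => k; exact: measurable_funM.
  - move=> w _; rewrite gee0_abs ?lee_fin ?sqr_ge0// sqr_enorm /dot.
    rewrite (bigD1 i)//= -expr2 lerDl.
    by apply: sumr_ge0 => k _; rewrite -expr2 sqr_ge0.
have U2 := coord2 _ normalizedU.
have V2 := coord2 _ normalizedV.
have U0 i : \int[P]_w tnth (U w) i = 0.
  by have := centeredU i; rewrite unlock /Rintegral => ->.
have V0 i : \int[P]_w tnth (V w) i = 0.
  by have := centeredV i; rewrite unlock /Rintegral => ->.
have isoU i j : \int[P]_w (tnth (U w) i * tnth (U w) j) = (i == j)%:R / d%:R.
  by have := isotropicU i j; rewrite unlock /Rintegral => ->.
have iprod (X Y : {RV P >-> d.-tuple R}) :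
    (forall i, P.-integrable setT (fun w => (tnth (X w) i ^+ 2)%:E)) ->
    (forall i, P.-integrable setT (fun w => (tnth (Y w) i ^+ 2)%:E)) ->
    forall i, P.-integrable setT (fun w => (tnth (X w) i * tnth (Y w) i)%:E).
  by move=> X2 Y2 i; exact: integrable_mul_sq.
have normV : \sum_(i < d) \int[P]_w (tnth (V w) i * tnth (V w) i) = 1.
  rewrite -Rintegral_bigsum; last exact: iprod.
  transitivity (fine 'E_P[fun w => (enorm (V w) ^+ 2)%R]); last by rewrite normalizedV.
  rewrite [in RHS]unlock; congr fine; apply: eq_integral => w _.
  by rewrite sqr_enorm.
have normU : \sum_(i < d) \int[P]_w (tnth (U w) i * tnth (U w) i) = 1.
  rewrite -Rintegral_bigsum; last exact: iprod.
  transitivity (fine 'E_P[fun w => (enorm (U w) ^+ 2)%R]); last by rewrite normalizedU.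
  rewrite [in RHS]unlock; congr fine; apply: eq_integral => w _.
  by rewrite sqr_enorm.
pose t := \sum_(i < d) \int[P]_w (tnth (U w) i * tnth (V w) i).
have d_gt0 : (0 < d)%N by exact: ltn_trans hd.
have d1 : 0 < d%:R - 1 :> R by rewrite subr_gt0 ltr1n.
have fE : f (fine 'E_P[fun w => (enorm (vsub (U w) (V w)) ^+ 2)%R]) = 1 - t ^+ 2.
  suff -> : fine 'E_P[fun w => (enorm (vsub (U w) (V w)) ^+ 2)%R] = 2 - 2 * t.
    by rewrite /f; field.
  rewrite unlock -[LHS]/(\int[P]_w (enorm (vsub (U w) (V w)) ^+ 2)).
  transitivity (\int[P]_w \sum_(i < d) (tnth (U w) i * tnth (U w) i
     + tnth (V w) i * tnth (V w) i - 2 * (tnth (U w) i * tnth (V w) i))).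
    apply: eq_Rintegral => w _; rewrite sqr_enorm; apply: eq_bigr => i _.
    by rewrite !tnth_mktuple; ring.
  have iUV i := integrable_scale 2 (iprod _ _ U2 V2 i).
  have iUU i : P.-integrable setT (fun w => (tnth (U w) i * tnth (U w) i
     + tnth (V w) i * tnth (V w) i)%:E).
    by under eq_fun do rewrite EFinD; apply: integrableD => //; exact: iprod.
  have iterm i : P.-integrable setT (fun w => (tnth (U w) i * tnth (U w) i
     + tnth (V w) i * tnth (V w) i - 2 * (tnth (U w) i * tnth (V w) i))%:E).
    by under eq_fun do rewrite EFinB; exact: integrableB.
  rewrite Rintegral_bigsum; last exact: iterm.
  rewrite (eq_bigr (fun i => \int[P]_w (tnth (U w) i * tnth (U w) i)
     + \int[P]_w (tnth (V w) i * tnth (V w) i)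
     - 2 * \int[P]_w (tnth (U w) i * tnth (V w) i))); last first.
    move=> i _; rewrite RintegralB//; [|exact: iUU|exact: iUV].
    rewrite RintegralD//; [|exact: iprod|exact: iprod].
    by rewrite RintegralZl//; exact: iprod.
  by rewrite sumrB big_split/= normU normV -mulr_sumr.
have lower := wedge_norm_lower_bound copy U2 V2 U0 V0 isoU normV d_gt0 (erefl t).
pose nu w := enorm (vsub (U w) (Us w)).
pose nv w := enorm (vsub (V w) (Vs w)).
pose s w := dot (vsub (U w) (Us w)) (vsub (V w) (Vs w)).
have mdot (X Y Z W : {RV P >-> d.-tuple R}) :
    measurable_fun [set: T] (fun w => dot (vsub (X w) (Y w)) (vsub (Z w) (W w))).
  apply: measurable_sum => i; under eq_fun do rewrite !tnth_mktuple.
  by apply: measurable_funM; exact: measurable_funB.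
have msqrt : measurable_fun [set: R] (@Num.sqrt R).
  exact: (continuous_measurable_fun (@sqrt_continuous R)).
have mnu : measurable_fun [set: T] nu by exact: (measurableT_comp msqrt).
have mnv : measurable_fun [set: T] nv by exact: (measurableT_comp msqrt).
have ms : measurable_fun [set: T] s by exact: mdot.
have nu0 w : 0 <= nu w by exact: enorm_ge0.
have nv0 w : 0 <= nv w by exact: enorm_ge0.
pose z w := nu w * nv w.
pose y w := z w - s w.
have mz : measurable_fun [set: T] z .
  exact: measurable_funM.
have my : measurable_fun [set: T] y by exact: measurable_funB.
have yz w : 0 <= y w <= 2 * z w.
  by have := cauchy_schwarz (vsub (U w) (Us w)) (vsub (V w) (Vs w));
    rewrite ler_norml -/(s w) -/(nu w) -/(nv w) -/(z w) => /andP[]; rewrite /y; lra.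
have wedgeE w : dot (vsub (U w) (Us w)) (vsub (U w) (Us w)) *
    dot (vsub (V w) (Vs w)) (vsub (V w) (Vs w)) - s w ^+ 2 = y w * (2 * z w - y w).
  by rewrite -!sqr_enorm -/(nu w) -/(nv w) /y /z; ring.
have {lower}lower : ((2 * (1 - d%:R^-1) * (1 - t ^+ 2))%:E <=
    \int[P]_w (y w * (2 * z w - y w))%:E)%E.
  by apply: le_trans lower _; under eq_integral do rewrite wedgeE.
have upper := defect_interpolation P my mz yz ha.
have a2 : 0 < 2 + a by lra.
have a1 : 0 < 1 + a by lra.
have mpow (h : T -> R) r : measurable_fun [set: T] h ->
    measurable_fun [set: T] (fun w => h w `^ r).
  by move=> mh; exact: (measurableT_comp (measurable_powR r)).
have moment : (\int[P]_w (z w `^ (2 + a))%:E <=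
   (\int[P]_w (nu w `^ (p1 * (2 + a)))%:E) `^ p1^-1 *
   (\int[P]_w (nv w `^ (p2 * (2 + a)))%:E) `^ p2^-1)%E.
  have := hoelder_ge0 P (mpow _ (2 + a) mnu) (mpow _ (2 + a) mnv) (fun w => powR_ge0 _ _)
   (fun w => powR_ge0 _ _) (lt_trans ltr01 hp1) (lt_trans ltr01 hp2) hp.
  congr (_ <= _ `^ _ * _ `^ _)%E; apply: eq_integral => w _.
  - by rewrite /z powRM.
  - by rewrite -powRrM mulrC.
  - by rewrite -powRrM mulrC.
have momentE (X Y : {RV P >-> d.-tuple R}) p : 1 < p ->
   (law_moment P X Y (p * (2 + a)) `^ ((2 + a) / (1 + a)) =
    ((\int[P]_w (enorm (vsub (X w) (Y w)) `^ (p * (2 + a)))%:E) `^ p^-1) `^ (1 + a)^-1)%E.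
  move=> p1'; rewrite /law_moment unlock -!poweRrM; congr (_ `^ _)%E.
  by field; rewrite !gt_eqF// (lt_trans ltr01).
rewrite fE (momentE U Us _ hp1) (momentE V Vs _ hp2) unlock.
set IU := (\int[P]_w (enorm (vsub (U w) (Us w)) `^ _)%:E)%E.
set IV := (\int[P]_w (enorm (vsub (V w) (Vs w)) `^ _)%:E)%E.
set Y := (\int[P]_w _)%E.
have c0 : 0 <= d%:R / (d%:R - 1) :> R by rewrite divr_ge0 ?ltW// ltr0n.
have k0 := k_alpha_ge0 ha.
have [tle|tgt] := leP (1 - t ^+ 2) 0.
  apply: (@le_trans _ _ 0%E); first by rewrite lee_fin.
  by rewrite !mule_ge0 ?poweR_ge0// lee_fin mulr_ge0.
(* [d / (d - 1)] cancels [1 - 1/d] and leaves [2 (1 - t^2)], at least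
   [1 - t^2] since this is positive here *)
apply: (@le_trans _ _ ((d%:R / (d%:R - 1))%:E * (2 * (1 - d%:R^-1) * (1 - t ^+ 2))%:E)%E).
  rewrite -EFinM lee_fin.
  rewrite (_ : _ * _ = 2 * (1 - t ^+ 2)); first by lra.
  by field; rewrite !gt_eqF// ltr0n.
apply: (@le_trans _ _ ((d%:R / (d%:R - 1))%:E *
   ((k_alpha a)%:E * (IU `^ p1^-1 `^ (1 + a)^-1 * IV `^ p2^-1 `^ (1 + a)^-1) * Y `^ (a / (1 + a))))%E).
  rewrite lee_wpmul2l ?lee_fin//; apply: le_trans lower _; apply: le_trans upper _.
  rewrite lee_wpmul2r ?poweR_ge0// lee_wpmul2l ?lee_fin//.
  rewrite -poweRM ?poweR_ge0//; apply: gt0_ler_poweR.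
  - by rewrite invr_ge0 ltW.
  - by rewrite in_itv/= leey andbT integral_ge0// => w _; rewrite lee_fin powR_ge0.
  - by rewrite in_itv/= leey andbT mule_ge0 ?poweR_ge0.
  exact: moment.
by rewrite [(k_alpha a * _)%R]mulrC EFinM !muleA.
Qed.
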